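(* Let $M,n\ge 1$ and let $f^i_m:\mathbb{R}^d\to\mathbb{R}$ ($m\in[M]$, $i\in[n]$) be differentiable, convex and $L$-smooth, with $f_m=\frac1n\sum_{i=1}^n f^i_m$ and $f=\frac1M\sum_{m=1}^M f_m$. Assume $f$ is $L$-smooth and $\mu$-strongly convex with $\mu>0$, and let $x_*$ be its minimizer. Run Nastya (Random-Reshuffling option) with client stepsize $\gamma>0$, server stepsize $\eta$ and cohort size $C\in\{1,\dots,M\}$, where $\gamma n\le \eta\le \frac{1}{16L}$. Then for every $T\ge 1$, $$\mathbb{E}\big[\|x_T-x_*\|^2\big]\le \Big(1-\frac{\eta\mu}{2}\Big)^T\|x_0-x_*\|^2+\frac{5\gamma^2 nL}{\mu}\Big(\frac1M\sum_{m=1}^M\sigma_{*,m}^2+n\sigma_*^2\Big)+\frac{8\eta}{\mu}\cdot\frac{M-C}{C\max\{M-1,1\}}\,\sigma_*^2 .$$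
   Context: Here $[k]=\{1,\dots,k\}$. A function $h$ is $L$-smooth if $\|\nabla h(x)-\nabla h(y)\|\le L\|x-y\|$ for all $x,y$. Algorithm Nastya (Random-Reshuffling option), with inputs $\gamma>0$, $\eta\ge0$, $C\in\{1,\dots,M\}$, $x_0\in\mathbb{R}^d$. For each round $t=0,1,\dots,T-1$: (i) sample a cohort $S_t\subseteq[M]$ uniformly at random among all subsets of cardinality $C$; (ii) for each $m\in S_t$, sample a permutation $\pi_m=(\pi_m^0,\dots,\pi_m^{n-1})$ of $[n]$ uniformly at random, and set $x^0_{t,m}=x_t$ and $x^{i+1}_{t,m}=x^i_{t,m}-\gamma\nabla f_m^{\pi_m^i}(x^i_{t,m})$ for $i=0,\dots,n-1$; (iii) set $g_{t,m}=\frac{1}{\gamma n}(x_t-x^n_{t,m})$, $g_t=\frac1C\sum_{m\in S_t}g_{t,m}$ and $x_{t+1}=x_t-\eta g_t$. All samplings (cohorts and permutations, across clients and rounds) are mutually independent and independent of the past. Notation: $\sigma_*^2=\frac1M\sum_{m=1}^M\|\nabla f_m(x_* )\|^2$ and $\sigma_{*,m}^2=\frac1n\sum_{i=1}^n\|\nabla f^i_m(x_* )\|^2$. *)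

(* Defs.v *)
From HB Require Import structures.
From mathcomp Require Import all_boot all_order all_algebra all_fingroup.
From mathcomp Require Import all_classical all_reals all_analysis.
Set Implicit Arguments. Unset Strict Implicit. Unset Printing Implicit Defensive.
Import Order.TTheory GRing.Theory Num.Theory numFieldNormedType.Exports.
Local Open Scope ring_scope.

Section Defs.
Variables (R : realType) (d : nat).
Notation V := 'rV[R]_d.

Definition dotv (u v : V) : R := \sum_(i < d) u 0 i * v 0 i.
Definition sqnorm (u : V) : R := dotv u u.
Definition enorm (u : V) : R := Num.sqrt (sqnorm u).

Definition grad (h : V -> R) (x : V) : V :=
  \row_(i < d) ('D_(delta_mx 0 i : V) h x).

Definition differentiable_everywhere (h : V -> R) : Prop :=
  forall x : V, differentiable h x.

Definition smooth (L : R) (h : V -> R) : Prop :=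
  forall x y : V, enorm (grad h x - grad h y) <= L * enorm (x - y).

Definition convex_fun (h : V -> R) : Prop :=
  forall (x y : V) (t : R), 0 <= t <= 1 ->
    h (t *: x + (1 - t) *: y) <= t * h x + (1 - t) * h y.

Definition strongly_convex (mu : R) (h : V -> R) : Prop :=
  forall (x y : V) (t : R), 0 <= t <= 1 ->
    h (t *: x + (1 - t) *: y)
      <= t * h x + (1 - t) * h y - mu / 2 * t * (1 - t) * sqnorm (x - y).

End Defs.

Section Nastya.
Variables (R : realType) (d M n : nat).
Variable F : 'I_M -> 'I_n -> 'rV[R]_d -> R.
Notation V := 'rV[R]_d.

Definition fm (m : 'I_M) : V -> R := fun x => n%:R^-1 * \sum_(i < n) F m i x.
Definition ftot : V -> R := fun x => M%:R^-1 * \sum_(m < M) fm m x.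

Definition sigma_star2 (xs : V) : R := M%:R^-1 * \sum_(m < M) sqnorm (grad (fm m) xs).
Definition sigma_star_m2 (xs : V) (m : 'I_M) : R :=
  n%:R^-1 * \sum_(i < n) sqnorm (grad (F m i) xs).

Definition local_run (gamma : R) (m : 'I_M) (pi : 'S_n) (x : V) : V :=
  foldl (fun y (i : 'I_n) => y - gamma *: grad (F m (pi i)) y) x (enum 'I_n).

(* Outcome of the randomness of one round: a cohort and a permutation for
   every client (only those of cohort members are used). *)
Definition round_outcome := ({set 'I_M} * {ffun 'I_M -> 'S_n})%type.

Definition valid_outcome (C : nat) (o : round_outcome) : bool := #|o.1| == C.

Definition nastya_step (gamma eta : R) (C : nat) (x : V) (o : round_outcome) : V :=
  let g_m := fun m => (gamma * n%:R)^-1 *: (x - local_run gamma m (o.2 m) x) in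
  let g := C%:R^-1 *: \sum_(m in o.1) g_m m in
  x - eta *: g.

Definition nastya_iterate (gamma eta : R) (C T : nat) (x0 : V)
    (w : {ffun 'I_T -> round_outcome}) : V :=
  foldl (nastya_step gamma eta C) x0 [seq w t | t <- enum 'I_T].

(* Expectation of a function of the T rounds' randomness, under the uniform
   law on (uniform cohorts of size C) x (uniform permutations), independent
   across rounds: the uniform average over all valid outcome sequences. *)
Definition valid_seq (C T : nat) (w : {ffun 'I_T -> round_outcome}) : bool :=
  [forall t, valid_outcome C (w t)].

Definition expect (C T : nat) (X : {ffun 'I_T -> round_outcome} -> R) : R :=
  (\sum_(w : {ffun 'I_T -> round_outcome} | valid_seq C w) X w)
    / #|[pred w : {ffun 'I_T -> round_outcome} | valid_seq C w]|%:R.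

End Nastya.

(* Main.v *)
Require Import Defs.
From HB Require Import structures.
From mathcomp Require Import all_boot all_order all_algebra all_fingroup.
From mathcomp Require Import all_classical all_reals all_analysis.
From mathcomp Require Import ring lra zify.
Import Order.TTheory GRing.Theory Num.Theory numFieldNormedType.Exports.
Local Open Scope ring_scope.

(** One round is analysed through the Bregman divergences [D_i] of the component
    functions between [xs] and the local iterates. The three-point identity turns
    the inner product of the server direction with [x - xs] into
    [f x - f xs + mean D] minus the mean drift of the local iterates. The squared
    norm of the direction, its cohort variance and the drift are all at most a small
    multiple of [mean D] (since [|grad h u - grad h v|^2 <= 4 L D_h(u, v)]) plus noise
    at [xs], so the positive term [mean D] absorbs them, and strong convexity gives
    the contraction factor [1 - eta mu]. The noise is estimated by the second moment
    of a sum over an exchangeable random set of fixed size, applied both to cohorts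
    and to the prefixes of the random permutations. *)

(** * Euclidean inner product, squared norm and gradients *)

Section Euclid.
Set Implicit Arguments. Unset Strict Implicit.
Context {R : realType} {d : nat}.
Notation V := 'rV[R]_d.
Implicit Types (u v w x y : V) (c : R).

Lemma dotvC u v : dotv u v = dotv v u.
Proof. by apply: eq_bigr => i _; rewrite mulrC. Qed.

Lemma dotvDl u v w : dotv (u + v) w = dotv u w + dotv v w.
Proof. by rewrite -big_split; apply: eq_bigr => i _; rewrite mxE mulrDl. Qed.

Lemma dotvZl c u v : dotv (c *: u) v = c * dotv u v.
Proof. by rewrite mulr_sumr; apply: eq_bigr => i _; rewrite mxE mulrA. Qed.

Lemma dotvNl u v : dotv (- u) v = - dotv u v.
Proof. by rewrite -scaleN1r dotvZl mulN1r. Qed.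

Lemma dotv0l v : dotv 0 v = 0.
Proof. by rewrite -(scale0r (0 : V)) dotvZl mul0r. Qed.

Lemma dotvDr u v w : dotv u (v + w) = dotv u v + dotv u w.
Proof. by rewrite !(dotvC u) dotvDl. Qed.

Lemma dotvZr c u v : dotv u (c *: v) = c * dotv u v.
Proof. by rewrite !(dotvC u) dotvZl. Qed.

Lemma dotvNr u v : dotv u (- v) = - dotv u v.
Proof. by rewrite !(dotvC u) dotvNl. Qed.

Lemma dotv_suml (I : Type) (r : seq I) (P : pred I) (a : I -> V) v :
  dotv (\sum_(i <- r | P i) a i) v = \sum_(i <- r | P i) dotv (a i) v.
Proof.
by elim/big_rec2: _ => [|i s t _ <-]; rewrite ?dotv0l ?dotvDl.
Qed.

Lemma dotv_sumr (I : Type) (r : seq I) (P : pred I) (a : I -> V) v :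
  dotv v (\sum_(i <- r | P i) a i) = \sum_(i <- r | P i) dotv v (a i).
Proof. by rewrite dotvC dotv_suml; apply: eq_bigr => i _; rewrite dotvC. Qed.

Lemma sqnorm_ge0 u : 0 <= sqnorm u.
Proof. by apply: sumr_ge0 => i _; rewrite -expr2 sqr_ge0. Qed.

Lemma sqnormD u v : sqnorm (u + v) = sqnorm u + 2 * dotv u v + sqnorm v.
Proof. rewrite /sqnorm !dotvDl !dotvDr (dotvC v u); ring. Qed.

Lemma sqnormN u : sqnorm (- u) = sqnorm u.
Proof. by rewrite /sqnorm dotvNl dotvNr opprK. Qed.

Lemma sqnormB u v : sqnorm (u - v) = sqnorm u - 2 * dotv u v + sqnorm v.
Proof. by rewrite sqnormD sqnormN dotvNr mulrN. Qed.

Lemma sqnormZ c u : sqnorm (c *: u) = c ^+ 2 * sqnorm u.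
Proof. by rewrite /sqnorm dotvZl dotvZr expr2 mulrA. Qed.

Lemma sqnorm0_eq0 u : sqnorm u = 0 -> u = 0.
Proof.
move=> /eqP; rewrite psumr_eq0 => [/allP u0|i _]; last by rewrite -expr2 sqr_ge0.
apply/rowP => i; rewrite mxE.
by have := u0 i (mem_index_enum i); rewrite /= -expr2 sqrf_eq0 => /eqP.
Qed.

Lemma sqnormD_le u v : sqnorm (u + v) <= 2 * sqnorm u + 2 * sqnorm v.
Proof. have := sqnorm_ge0 (u - v); rewrite sqnormB sqnormD; lra. Qed.

(** Cauchy-Schwarz: expanding the nonnegative double sum of [sqnorm (a i - a j)] gives twice the
    difference of the two sides. *)
Lemma sqnorm_sum_le (I : finType) (P : pred I) (a : I -> V) :
  sqnorm (\sum_(i | P i) a i) <= #|P|%:R * \sum_(i | P i) sqnorm (a i).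
Proof.
have : 0 <= \sum_(i | P i) \sum_(j | P j) sqnorm (a i - a j).
  by apply: sumr_ge0 => i _; apply: sumr_ge0 => j _; exact: sqnorm_ge0.
under eq_bigr => i _ do under eq_bigr => j _ do rewrite sqnormB.
under eq_bigr => i _ do
  rewrite big_split sumrB /= sumr_const -mulr_sumr -dotv_sumr -(mulr_natl (sqnorm _)).
rewrite big_split sumrB /= sumr_const -!mulr_sumr -dotv_suml.
rewrite -(mulr_natl (\sum_(_ | _) _)) -[dotv _ _]/(sqnorm _); lra.
Qed.

Lemma smoothE L (h : V -> R) : 0 < L -> smooth L h -> forall x y,
  sqnorm (grad h x - grad h y) <= L ^+ 2 * sqnorm (x - y).
Proof.
move=> L0 sh x y; have := sh x y.
rewrite -(ler_pXn2r (ltn0Sn 1)) ?nnegrE ?mulr_ge0 ?sqrtr_ge0 ?(ltW L0)//.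
by rewrite exprMn !sqr_sqrtr ?sqnorm_ge0.
Qed.

Lemma derive_dotv (h : V -> R) x v :
  differentiable h x -> 'D_v h x = dotv (grad h x) v.
Proof.
move=> dh; rewrite deriveE// {1}(row_sum_delta v) linear_sum.
by apply: eq_bigr => i _; rewrite linearZ/= mxE deriveE// mulrC.
Qed.

(** By convexity the difference quotients at [x] towards [y] are at most [h y - h x] for steps in
    [(0, 1]]; the bound passes to the right limit at 0, which is the directional derivative. *)
Lemma convex_grad_le (h : V -> R) x y : differentiable h x -> convex_fun h ->
  dotv (grad h x) (y - x) <= h y - h x.
Proof.
move=> dh ch; rewrite -derive_dotv//.
have dr : derivable h x (y - x) by exact: diff_derivable.
apply: (cvgr_to_le (cvg_dnbhs_at_right dr)); near=> t.
have t0 : 0 < t by [].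
have t1 : t <= 1 by near: t; apply: nbhs_right_le.
rewrite /=.
have -> : t *: (y - x) + x = t *: y + (1 - t) *: x.
  by rewrite scalerBr scalerBl scale1r -addrA (addrC x).
rewrite [_ *: _]mulrC ler_pdivrMr//.
have := ch y x t; rewrite (ltW t0) t1 => /(_ isT); lra.
Unshelve. all: by end_near. Qed.

(** * Bregman divergences of smooth convex functions *)

Section Smooth.
Variables (L : R) (h : V -> R).
Hypotheses (L0 : 0 < L) (dh : differentiable_everywhere h).
Hypotheses (ch : convex_fun h) (sh : smooth L h).

Definition bregman x y := h x - h y - dotv (grad h y) (x - y).

Lemma bregman_ge0 x y : 0 <= bregman x y.
Proof. by rewrite subr_ge0 convex_grad_le. Qed.

(* Convexity alone bounds the divergence by [dotv (grad h x - grad h y) (x - y)];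
   the constant is [L] instead of the sharp [L / 2], which is enough. *)
Lemma bregman_le x y : bregman x y <= L * sqnorm (x - y).
Proof.
have hx := @convex_grad_le h x y (dh x) ch.
have hs := smoothE L0 sh x y.
have := sqnorm_ge0 (grad h x - grad h y - L *: (x - y)).
rewrite (sqnormB (_ - _) (L *: _)) dotvZr sqnormZ [dotv (_ - _) _]dotvDl dotvNl => hc.
have {hs hc} : L * (dotv (grad h x) (x - y) - dotv (grad h y) (x - y))
    <= L * (L * sqnorm (x - y)) by nra.
rewrite ler_pM2l// /bregman => hc.
by rewrite -opprB dotvNr in hx; lra.
Qed.

(** Co-coercivity, by evaluating [h] at the gradient-type step [z = x - c *: g]: the tangent at [y]
    bounds [h z] from below, [bregman_le] at [x] bounds it from above. The value [c = 1 / (2 L)]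
    maximises the gain [c - L c^2], which is then [1 / (4 L)]. *)
Lemma sqnorm_gradB_le x y : sqnorm (grad h x - grad h y) <= 4 * L * bregman x y.
Proof.
set g := grad h x - grad h y; pose c := (2 * L)^-1; pose z := x - c *: g.
have zx : z - x = - (c *: g) by rewrite /z addrAC subrr add0r.
have zy : z - y = (x - y) - c *: g by rewrite /z addrAC.
have h1 := bregman_ge0 z y; have h2 := bregman_le z x.
rewrite /bregman zx sqnormN sqnormZ dotvNr dotvZr in h2.
rewrite /bregman zy (dotvDr _ (x - y)) (dotvNr _ (c *: g)) dotvZr in h1.
have gE : sqnorm g = dotv (grad h x) g - dotv (grad h y) g.
  by rewrite {1}/g /sqnorm dotvDl dotvNl.
have cgE : c * sqnorm g = c * dotv (grad h x) g - c * dotv (grad h y) g.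
  by rewrite gE mulrBr.
have c2 : 2 * (L * c) = 1 by rewrite /c; field; rewrite gt_eqF.
have Lc : L * (c ^+ 2 * sqnorm g) = (c / 2) * sqnorm g.
  by transitivity (2 * (L * c) * (c / 2 * sqnorm g)); [field|rewrite c2 mul1r].
rewrite Lc in h2.
have : c * sqnorm g <= 2 * bregman x y by rewrite /bregman; lra.
move=> hc; have -> : sqnorm g = 2 * L * (c * sqnorm g).
  by rewrite !mulrA -(mulrA 2) c2 mul1r.
have -> : 4 * L * bregman x y = 2 * L * (2 * bregman x y) by ring.
by rewrite ler_pM2l// mulr_gt0.
Qed.

End Smooth.
End Euclid.

(** * Moments of sums over an exchangeable random set of fixed size *)

Section Sampling.
Set Implicit Arguments. Unset Strict Implicit.
Context {R : realType} {d : nat} {J Om : finType}.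
Variables (A : pred Om) (U : Om -> {set J}) (k : nat).
Hypothesis card_U : forall w, A w -> #|U w| = k.
Hypothesis exchangeable : forall (s : {perm J}) (Phi : {set J} -> R),
  \sum_(w | A w) Phi (s @: U w) = \sum_(w | A w) Phi (U w).

(** Inclusion probabilities of first and second order, left unnormalised: both are counts of
    outcomes, so a factor [#|A|] replaces any division. *)
Definition incl1 (j : J) : R := \sum_(w | A w) (j \in U w)%:R.
Definition incl2 (i j : J) : R := \sum_(w | A w) ((i \in U w) && (j \in U w))%:R.

Lemma incl1_perm (s : {perm J}) j : incl1 (s j) = incl1 j.
Proof.
rewrite /incl1 -(exchangeable s (fun B => (s j \in B)%:R)).
by apply: eq_bigr => w _; rewrite mem_imset//; exact: perm_inj.
Qed.

Lemma incl2_perm (s : {perm J}) i j : incl2 (s i) (s j) = incl2 i j.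
Proof.
rewrite /incl2 -(exchangeable s (fun B => ((s i \in B) && (s j \in B))%:R)).
by apply: eq_bigr => w _; rewrite !mem_imset//; exact: perm_inj.
Qed.

Lemma incl1_const i j : incl1 i = incl1 j.
Proof. by rewrite -(incl1_perm (tperm i j) i) tpermL. Qed.

(** Permutations act transitively on ordered pairs of distinct elements: [t] moves [i] to [i'], and
    the second transposition moves [t j] to [j'] while fixing [i']. *)
Lemma incl2_const i j i' j' : i != j -> i' != j' -> incl2 i j = incl2 i' j'.
Proof.
move=> ij ij'.
pose t := tperm i i'; pose s := (t * tperm (t j) j')%g.
rewrite -(incl2_perm s i j); congr incl2; rewrite /s permM ?tpermL//.
rewrite tpermD// 1?eq_sym// -[X in X != _](tpermL i i').
by rewrite (inj_eq perm_inj).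
Qed.

Lemma sum_mem_U w : A w -> \sum_j (j \in U w)%:R = k%:R :> R.
Proof.
move=> Aw; rewrite -(card_U Aw) -sum1_card natr_sum [RHS]big_mkcond.
by apply: eq_bigr => j _; case: (_ \in _).
Qed.

Lemma incl1E j : #|J|%:R * incl1 j = #|A|%:R * k%:R.
Proof.
transitivity (\sum_(i : J) incl1 i).
  rewrite (eq_bigr (fun=> incl1 j)) => [|i _]; last exact: incl1_const.
  by rewrite sumr_const mulr_natl.
rewrite exchange_big/= (eq_bigr (fun=> k%:R)) ?sumr_const ?mulr_natl// => w Aw.
exact: sum_mem_U.
Qed.

(** Double counting: each [U w] contains [k (k - 1)] ordered pairs of distinct elements, and all
    such pairs of [J] are included equally often. *)
Lemma incl2E i j : i != j ->
  #|J|%:R * (#|J|%:R - 1) * incl2 i j = #|A|%:R * (k%:R * (k%:R - 1)).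
Proof.
move=> ij.
transitivity (\sum_(i' : J) \sum_(j' | j' != i') incl2 i' j').
  rewrite (eq_bigr (fun=> (#|J|%:R - 1) * incl2 i j)).
    by rewrite sumr_const -[RHS]mulr_natl mulrA.
  move=> i' _; rewrite (eq_bigr (fun=> incl2 i j)) => [|j' ij']; last first.
    by apply: incl2_const; rewrite // eq_sym.
  rewrite sumr_const -[LHS]mulr_natl; congr (_ * _).
  rewrite cardC1 -subn1 natrB//.
  by apply/card_gt0P; exists i.
transitivity (\sum_i' (\sum_j' incl2 i' j' - incl1 i')).
  apply: eq_bigr => i' _; rewrite [in RHS](bigD1 i')//= addrC -addrA.
  rewrite (_ : incl2 i' i' = incl1 i') ?addrN ?addr0//.
  by apply: eq_bigr => w _; rewrite andbb.
rewrite sumrB (eq_bigr (fun i' => \sum_(w | A w) (i' \in U w)%:R * k%:R)).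
  rewrite exchange_big [X in _ - X]exchange_big/= -sumrB.
  rewrite (eq_bigr (fun=> k%:R * (k%:R - 1))) ?sumr_const ?mulr_natl// => w Aw.
  by rewrite -mulr_suml sum_mem_U//; ring.
move=> i' _; rewrite exchange_big/=; apply: eq_bigr => w Aw.
rewrite -(sum_mem_U Aw) mulr_sumr; apply: eq_bigr => j' _.
by rewrite -natrM mulnb.
Qed.

Lemma sum_sampling (b : J -> R) :
  #|J|%:R * \sum_(w | A w) \sum_(j in U w) b j = #|A|%:R * k%:R * \sum_j b j.
Proof.
under eq_bigr => w _ do rewrite big_mkcond/=.
rewrite exchange_big/= !mulr_sumr; apply: eq_bigr => j _.
rewrite -(incl1E j) -mulrA /incl1 mulr_suml; congr (_ * _).
by apply: eq_bigr => w _; case: ifP; rewrite ?mul1r ?mul0r.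
Qed.

Lemma sum_sampling_sqnorm (a : J -> 'rV[R]_d) :
  \sum_(w | A w) sqnorm (\sum_(j in U w) a j) =
  \sum_i incl1 i * sqnorm (a i) + \sum_i \sum_(j | j != i) incl2 i j * dotv (a i) (a j).
Proof.
transitivity (\sum_i \sum_j incl2 i j * dotv (a i) (a j)).
  transitivity (\sum_(w | A w) \sum_i \sum_j ((i \in U w) && (j \in U w))%:R * dotv (a i) (a j)).
    apply: eq_bigr => w _; rewrite /sqnorm dotv_suml big_mkcond/=; apply: eq_bigr => i _.
    rewrite dotv_sumr big_mkcond/=; case: ifP => _.
      by apply: eq_bigr => j _; case: ifP => _; rewrite ?mul1r ?mul0r.
    by rewrite big1// => j _; rewrite mul0r.
  rewrite exchange_big/=; apply: eq_bigr => i _.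
  rewrite exchange_big/=; apply: eq_bigr => j _.
  by rewrite mulr_suml.
rewrite -big_split/=; apply: eq_bigr => i _; rewrite (bigD1 i)//=; congr (_ * _ + _).
by apply: eq_bigr => w _; rewrite andbb.
Qed.

(** The second moment of sampling without replacement is known exactly from [incl1E] and [incl2E].
    The inequality comes from replacing the centred variance of the population by its raw second
    moment. *)
Lemma sampling_second_moment (a : J -> 'rV[R]_d) : (0 < #|J|)%N -> (k <= #|J|)%N ->
  \sum_(w | A w) sqnorm (\sum_(j in U w) a j) <=
  #|A|%:R * (k%:R ^+ 2 * sqnorm (#|J|%:R^-1 *: \sum_j a j) +
    k%:R * (#|J| - k)%:R / (maxn (#|J| - 1) 1)%:R * (#|J|%:R^-1 * \sum_j sqnorm (a j))).
Proof.
move=> J0 kJ; rewrite sum_sampling_sqnorm sqnormZ.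
set Q := \sum_j sqnorm (a j); set P := sqnorm (\sum_j a j).
have P0 : 0 <= P by exact: sqnorm_ge0.
have JR : #|J|%:R != 0 :> R by rewrite pnatr_eq0 -lt0n.
have PQ : \sum_i \sum_(j | j != i) dotv (a i) (a j) = P - Q.
  rewrite /P /sqnorm dotv_suml -sumrB; apply: eq_bigr => i _.
  by rewrite dotv_sumr [in RHS](bigD1 i)//= addrC addrK.
have -> : \sum_i incl1 i * sqnorm (a i) = #|A|%:R * k%:R / #|J|%:R * Q.
  rewrite mulr_sumr; apply: eq_bigr => i _; congr (_ * _).
  by rewrite -(incl1E i) mulrAC divff// mul1r.
have [J1|J1] := leqP #|J| 1.
  (* A single element: there are no off-diagonal pairs, [k] is 0 or 1, and the variance term
     vanishes because [k (1 - k) = 0], whatever its denominator. *)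
  have {}J1 : #|J| = 1%N by apply/eqP; rewrite eqn_leq J1.
  have Jeq (i j : J) : j = i by apply/fintype_le1P; rewrite J1.
  have PQ0 : P = Q.
    apply/eqP; rewrite -subr_eq0 -PQ big1// => i _; rewrite big1// => j /negP[].
    by rewrite (Jeq i j).
  have -> : \sum_i \sum_(j | j != i) incl2 i j * dotv (a i) (a j) = 0.
    rewrite big1// => i _; rewrite big1// => j /negP[].
    by rewrite (Jeq i j).
  rewrite PQ0 J1 in kJ *.
  case: k kJ => [|[|]]//= _;
    by rewrite invr1 ?(expr0n, expr1n, mulr1, mul1r, mul0r, mulr0, addr0).
have JR1 : #|J|%:R - 1 != 0 :> R by rewrite subr_eq0 pnatr_eq1 gtn_eqF.
have -> : \sum_i \sum_(j | j != i) incl2 i j * dotv (a i) (a j) =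
    #|A|%:R * (k%:R * (k%:R - 1)) / (#|J|%:R * (#|J|%:R - 1)) * (P - Q).
  rewrite -PQ mulr_sumr; apply: eq_bigr => i _; rewrite mulr_sumr; apply: eq_bigr => j ij.
  by rewrite -(incl2E (j := j) (i := i)) 1?eq_sym//; field; rewrite JR JR1.
rewrite (maxn_idPl _) ?subn_gt0// natrB// natrB// -subr_ge0.
(* The terms in [Q] cancel; what remains is the squared mean dropped from the variance. *)
rewrite [X in 0 <= X](_ : _ = #|A|%:R * P * (k%:R * (#|J|%:R - k%:R)) /
   (#|J|%:R ^+ 2 * (#|J|%:R - 1))); last by field; rewrite JR JR1.
by rewrite divr_ge0 ?mulr_ge0 ?subr_ge0 ?ler_nat ?exprn_ge0 ?ler1n.
Qed.
End Sampling.

(** * Iterating a one-round estimate over independent rounds *)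

Section Rounds.
Set Implicit Arguments. Unset Strict Implicit.
Context {R : realType} {O : finType} {X : Type}.
Variables (A : pred O) (step : X -> O -> X) (Phi : X -> R) (a B : R).

Definition fcons T (o : O) (w : {ffun 'I_T -> O}) : {ffun 'I_T.+1 -> O} :=
  [ffun i => if unlift ord0 i is Some j then w j else o].

Lemma fcons0 T o (w : {ffun 'I_T -> O}) : fcons o w ord0 = o.
Proof. by rewrite ffunE unlift_none. Qed.

Lemma fconsS T o (w : {ffun 'I_T -> O}) i : fcons o w (lift ord0 i) = w i.
Proof. by rewrite ffunE liftK. Qed.

Lemma sum_ffun_recl T (P : pred {ffun 'I_T.+1 -> O}) (G : {ffun 'I_T.+1 -> O} -> R) :
  \sum_(w | P w) G w = \sum_o \sum_(w : {ffun 'I_T -> O} | P (fcons o w)) G (fcons o w).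
Proof.
rewrite pair_big_dep/=.
rewrite (reindex (fun ow : O * {ffun 'I_T -> O} => fcons ow.1 ow.2))//=.
exists (fun w : {ffun 'I_T.+1 -> O} => (w ord0, [ffun i => w (lift ord0 i)])).
  move=> [p w] _ /=; rewrite fcons0; congr pair.
  by apply/ffunP => i; rewrite !ffunE liftK.
move=> w _; apply/ffunP => i; rewrite ffunE.
by case: unliftP => [j ->|->]; rewrite ?ffunE.
Qed.

Lemma rounds_contraction T x : 0 <= a ->
  (forall x, \sum_(o | A o) Phi (step x o) <= #|A|%:R * (a * Phi x + (1 - a) * B)) ->
  \sum_(w : {ffun 'I_T -> O} | [forall t, A (w t)])
     Phi (foldl step x [seq w t | t <- enum 'I_T])
  <= #|A|%:R ^+ T * (a ^+ T * Phi x + (1 - a ^+ T) * B).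
Proof.
move=> a0 h1; elim: T x => [|T IH] x.
  under eq_bigr => w _ do rewrite (size0nil (size_enum_ord 0))/=.
  rewrite (big_pred1 [ffun i : 'I_0 => False_rect O (notF (ltn_ord i))]); last first.
    move=> w /=; transitivity true; first by apply/forallP => -[].
    by symmetry; apply/eqP/ffunP => -[].
  by rewrite !expr0; lra.
rewrite sum_ffun_recl.
have -> : \sum_o \sum_(w : {ffun 'I_T -> O} | [forall t, A (fcons o w t)])
      Phi (foldl step x [seq fcons o w t | t <- enum 'I_T.+1]) =
    \sum_(o | A o) \sum_(w : {ffun 'I_T -> O} | [forall t, A (w t)])
      Phi (foldl step (step x o) [seq w t | t <- enum 'I_T]).
  rewrite [RHS]big_mkcond; apply: eq_bigr => o _.
  have vE (w : {ffun 'I_T -> O}) :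
      [forall t, A (fcons o w t)] = A o && [forall t, A (w t)].
    apply/forallP/andP => [h|[Ao /forallP h] t].
      split; first by rewrite -(fcons0 o w).
      by apply/forallP => t; rewrite -(fconsS o).
    by rewrite ffunE; case: unliftP.
  under eq_bigl => w do rewrite vE.
  case: (A o); last by rewrite big_pred0.
  apply: eq_bigr => w _; rewrite enum_ordSl/= fcons0 -map_comp.
  by congr (Phi (foldl _ _ _)); apply: eq_map => i /=; rewrite fconsS.
apply: le_trans (ler_sum _ (fun o _ => IH (step x o))) _.
rewrite -mulr_sumr exprSr -mulrA ler_wpM2l ?exprn_ge0//.
rewrite big_split/= -mulr_sumr sumr_const -[_ *+ _]mulr_natl.
have := ler_wpM2l (exprn_ge0 T a0) (h1 x).
by rewrite exprSr; lra.
Qed.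

Lemma card_valid_rounds T :
  #|[pred w : {ffun 'I_T -> O} | [forall t, A (w t)]]| = (#|A| ^ T)%N.
Proof. by rewrite -[in RHS](card_ord T) -card_ffun_on; apply: eq_card => w. Qed.
End Rounds.

(** * Exchangeability of cohorts and of permutation prefixes *)

Section Exchangeable.
Set Implicit Arguments. Unset Strict Implicit.
Context {R : realType}.

Lemma cohort_exchangeable (M C : nat) (s : 'S_M) (Phi : {set 'I_M} -> R) :
  \sum_(S : {set 'I_M} | #|S| == C) Phi (s @: S) =
  \sum_(S : {set 'I_M} | #|S| == C) Phi S.
Proof.
rewrite [RHS](reindex (fun S : {set 'I_M} => s @: S))/=.
  by apply: eq_bigl => S; rewrite card_imset//; exact: perm_inj.
exists (fun S : {set 'I_M} => s^-1%g @: S) => S _; rewrite -imset_comp.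
  by rewrite (eq_imset (g := id)) ?imset_id// => i; rewrite /= permK.
by rewrite (eq_imset (g := id)) ?imset_id// => i; rewrite /= permKV.
Qed.

Lemma card_ord_prefix n k : (k <= n)%N -> #|[set i : 'I_n | (i < k)%N]| = k.
Proof.
move=> kn; rewrite -[RHS]card_ord -[RHS]sum1_card (big_ord_widen _ (fun=> 1%N) kn).
by rewrite -sum1_card; apply: eq_bigl => i; rewrite inE.
Qed.

(** Composing the permutation of every client with [s] is a bijection of the outcomes, and it moves
    the prefix image of client [m] by [s]. *)
Lemma prefix_exchangeable (M n k : nat) (m : 'I_M) (s : 'S_n) (Phi : {set 'I_n} -> R) :
  \sum_(p : {ffun 'I_M -> 'S_n}) Phi (s @: (p m @: [set i : 'I_n | (i < k)%N])) =
  \sum_(p : {ffun 'I_M -> 'S_n}) Phi (p m @: [set i : 'I_n | (i < k)%N]).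
Proof.
rewrite [RHS](reindex (fun p : {ffun 'I_M -> 'S_n} => [ffun m' => (p m' * s)%g]))/=.
  apply: eq_bigr => p _; rewrite -imset_comp ffunE; congr Phi.
  by apply: eq_imset => i; rewrite /= permM.
exists (fun p : {ffun 'I_M -> 'S_n} => [ffun m' => (p m' * s^-1)%g]) => p _;
  by apply/ffunP => m'; rewrite !ffunE ?mulgK ?mulgKV.
Qed.
End Exchangeable.

(** * One local pass of one client, in a fixed order of its components *)

Section Client.
Set Implicit Arguments. Unset Strict Implicit.
Context {R : realType} {d n : nat}.
Notation V := 'rV[R]_d.
Variables (h : 'I_n -> V -> R) (L gamma : R) (xs x : V).
Hypotheses (n0 : (0 < n)%N) (L0 : 0 < L) (gamma0 : 0 < gamma).
Hypothesis small : 16 * L * (gamma * n%:R) <= 1.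
Hypothesis dh : forall i, differentiable_everywhere (h i).
Hypothesis ch : forall i, convex_fun (h i).
Hypothesis sh : forall i, smooth L (h i).

(** The local iterate after [k] steps. The components are visited in their index order; a
    permutation is accounted for by permuting the family [h]. *)
Definition pass_prefix (k : nat) : V :=
  foldl (fun y i => y - gamma *: grad (h i) y) x (take k (enum 'I_n)).

Lemma pass_prefixE k : (k <= n)%N ->
  pass_prefix k = x - gamma *: \sum_(i < n | (i < k)%N) grad (h i) (pass_prefix i).
Proof.
elim: k => [|k IH] kn; first by rewrite /pass_prefix take0 big_pred0// scaler0 subr0.
rewrite {1}/pass_prefix (take_nth (Ordinal kn)) ?size_enum_ord// foldl_rcons.
rewrite -/(pass_prefix k) (nth_ord_enum _ (Ordinal kn)).
rewrite [X in X - _](IH (ltnW kn)) -addrA -opprD -scalerDr; congr (_ - _ *: _).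
rewrite [RHS](bigD1 (Ordinal kn))/= ?ltnS// addrC; congr (_ + _).
by apply: eq_bigl => i; rewrite ltnS (leq_eqVlt i) -val_eqE/=; lia.
Qed.

Let y (i : 'I_n) := pass_prefix i.
Let g := (gamma * n%:R)^-1 *: (x - pass_prefix n).
Let Dbar := n%:R^-1 * \sum_i bregman (h i) xs (y i).

Let nR0 : 0 < n%:R :> R. Proof. by rewrite ltr0n. Qed.
Let nRn0 : n%:R != 0 :> R. Proof. by rewrite gt_eqF. Qed.

Lemma pass_directionE : g = n%:R^-1 *: \sum_i grad (h i) (y i).
Proof.
rewrite /g pass_prefixE// opprB addrC subrK scalerA invfM mulrAC mulVf ?gt_eqF// mul1r.
by congr (_ *: _); apply: eq_bigl => i; rewrite ltn_ord.
Qed.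

Lemma sqnorm_avg_le (a : 'I_n -> V) :
  sqnorm (n%:R^-1 *: \sum_i a i) <= n%:R^-1 * \sum_i sqnorm (a i).
Proof.
rewrite sqnormZ expr2 -mulrA ler_pM2l ?invr_gt0//.
by rewrite mulrC ler_pdivrMr// mulrC -[n in n%:R]card_ord; exact: sqnorm_sum_le.
Qed.

Lemma avg_bregman_ge0 : 0 <= Dbar.
Proof.
by rewrite mulr_ge0 ?invr_ge0 ?ler0n// sumr_ge0// => i _; exact: bregman_ge0.
Qed.

Lemma gradB_bregman_le i z :
  sqnorm (grad (h i) z - grad (h i) xs) <= 4 * L * bregman (h i) xs z.
Proof. by rewrite -sqnormN opprB sqnorm_gradB_le. Qed.

Lemma pass_direction_dev :
  sqnorm (g - n%:R^-1 *: \sum_i grad (h i) xs) <= 4 * L * Dbar.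
Proof.
rewrite pass_directionE -scalerBr -sumrB (le_trans (sqnorm_avg_le _))//.
rewrite [leRHS]mulrCA ler_pM2l ?invr_gt0// mulr_sumr.
by apply: ler_sum => i _; exact: gradB_bregman_le.
Qed.

Let W := n%:R^-1 * \sum_(i < n) sqnorm (\sum_(j < n | (j < i)%N) grad (h j) xs).

(** The displacement [y i - x] is [- gamma] times a sum of gradients at earlier iterates. Replacing
    these by gradients at [xs] costs a multiple of [Dbar] by Cauchy-Schwarz over at most [n] terms
    and co-coercivity; what is left is the prefix noise [W]. *)
Lemma pass_drift :
  n%:R^-1 * \sum_i sqnorm (y i - x) <=
  8 * L * (gamma * n%:R) ^+ 2 * Dbar + 2 * gamma ^+ 2 * W.
Proof.
have -> : 8 * L * (gamma * n%:R) ^+ 2 * Dbar + 2 * gamma ^+ 2 * W = n%:R^-1 *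
    \sum_(i < n) (2 * gamma ^+ 2 * (n%:R * (4 * L * (n%:R * Dbar)))
      + 2 * gamma ^+ 2 * sqnorm (\sum_(j < n | (j < i)%N) grad (h j) xs)).
  rewrite big_split/= sumr_const card_ord -[_ *+ n]mulr_natl -mulr_sumr /W.
  by move: Dbar => D; field.
rewrite ler_pM2l ?invr_gt0//; apply: ler_sum => i _.
rewrite /y pass_prefixE ?(ltnW (ltn_ord i))// addrAC subrr add0r sqnormN sqnormZ.
set G := \sum_(j < n | _) _; set G' := \sum_(j < n | _) grad (h j) xs.
have nD : n%:R * Dbar = \sum_j bregman (h j) xs (y j) by rewrite /Dbar mulrA divff// mul1r.
suff GG' : sqnorm (G - G') <= n%:R * (4 * L * (n%:R * Dbar)).
  have := sqnormD_le (G - G') G'; rewrite subrK => hG.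
  have {}hG : sqnorm G <= 2 * (n%:R * (4 * L * (n%:R * Dbar))) + 2 * sqnorm G' by lra.
  have := ler_wpM2l (sqr_ge0 gamma) hG; lra.
rewrite -sumrB (le_trans (sqnorm_sum_le _ _))// ler_pM ?ler0n//.
- by apply: sumr_ge0 => j _; exact: sqnorm_ge0.
- by rewrite ler_nat (leq_trans (max_card _))// card_ord.
rewrite nD mulr_sumr [leRHS](bigID (fun j : 'I_n => (j < i)%N))/= ler_wpDr//.
  by apply: sumr_ge0 => j _; rewrite mulr_ge0 ?bregman_ge0// mulr_ge0 ?ltW.
by apply: ler_sum => j _; exact: gradB_bregman_le.
Qed.

(** Three-point identity: [dotv (grad (h i) (y i)) (x - xs)] equals [h i x - h i xs] plus the
    divergence of [xs] from [y i] minus that of [x] from [y i]. The last one is at most [L] times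
    the squared drift. *)
Lemma pass_progress :
  n%:R^-1 * \sum_i (h i x - h i xs) + Dbar / 2 - 2 * L * gamma ^+ 2 * W
  <= dotv g (x - xs).
Proof.
have : n%:R^-1 * \sum_i (h i x - h i xs) + Dbar - L * (n%:R^-1 * \sum_i sqnorm (y i - x))
    <= dotv g (x - xs).
  rewrite mulrCA -mulrDr -mulrBr pass_directionE dotvZl dotv_suml ler_pM2l ?invr_gt0//.
  rewrite mulr_sumr -big_split -sumrB/=; apply: ler_sum => i _.
  have := bregman_le L0 (dh i) (ch i) (sh i) x (y i).
  rewrite -(sqnormN (x - y i)) opprB {1}/bregman => hb.
  have e z : dotv (grad (h i) (y i)) (z - y i) =
      dotv (grad (h i) (y i)) z - dotv (grad (h i) (y i)) (y i) by rewrite dotvDr dotvNr.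
  by rewrite /bregman; rewrite !e in hb *; rewrite dotvDr dotvNr; lra.
move=> /(le_trans _); apply.
have : L * (n%:R^-1 * \sum_i sqnorm (y i - x)) <=
   L * (8 * L * (gamma * n%:R) ^+ 2 * Dbar + 2 * gamma ^+ 2 * W).
  by rewrite ler_pM2l// pass_drift.
(* Hence the drift contribution [8 L^2 (gamma n)^2 Dbar] is at most [Dbar / 32], within the half of
   [Dbar] given up. *)
have : (16 * L * (gamma * n%:R)) ^+ 2 * Dbar <= Dbar.
  rewrite ler_piMl ?avg_bregman_ge0// exprn_ile1//.
  by rewrite !mulr_ge0 ?ler0n ?ltW.
rewrite exprMn exprMn; have := avg_bregman_ge0; lra.
Qed.

End Client.

(** Bounds by [n] the variance factor of a random prefix of length [i]. *)
Lemma muln_sub_le_max (n i : nat) : (i < n)%N -> (i * (n - i) <= n * maxn (n - 1) 1)%N.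
Proof. by case: i => [//|k] kn; apply: leq_mul; lia. Qed.

Lemma subn_le_muln_max (M C : nat) : (0 < C)%N -> (M - C <= C * maxn (M - 1) 1)%N.
Proof. by move=> C0; rewrite -(mul1n (M - C)%N); apply: leq_mul; lia. Qed.

(** * The server step: optimality at the minimizer, averaging over clients, cohorts and
    permutations *)

Section Server.
Set Implicit Arguments. Unset Strict Implicit.
Context {R : realType} {d M n : nat}.
Notation V := 'rV[R]_d.
Variables (F : 'I_M -> 'I_n -> V -> R) (L mu gamma eta : R) (C : nat) (xs : V).
Hypotheses (M0 : (0 < M)%N) (n0 : (0 < n)%N).
Hypothesis dF : forall m i, differentiable_everywhere (F m i).
Hypothesis cF : forall m i, convex_fun (F m i).
Hypothesis sF : forall m i, smooth L (F m i).
Hypothesis scf : strongly_convex mu (ftot F).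
Hypothesis xs_min : forall y, ftot F xs <= ftot F y.
Hypotheses (gamma0 : 0 < gamma) (C0 : (1 <= C)%N) (CM : (C <= M)%N).
Hypotheses (gamma_eta : gamma * n%:R <= eta) (L0 : 0 < L) (etaL : 16 * L * eta <= 1).

Let MR0 : 0 < M%:R :> R. Proof. by rewrite ltr0n. Qed.
Let nR0 : 0 < n%:R :> R. Proof. by rewrite ltr0n. Qed.
Let CR0 : 0 < C%:R :> R. Proof. by rewrite ltr0n. Qed.
Let eta0 : 0 < eta. Proof. by apply: lt_le_trans gamma_eta; rewrite mulr_gt0. Qed.

Lemma mean_const k (c : R) : (0 < k)%N -> k%:R^-1 * \sum_(i < k) c = c.
Proof.
by move=> k0; rewrite sumr_const card_ord -[c *+ k]mulr_natl mulKf// pnatr_eq0 -lt0n.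
Qed.

Lemma grad_fm m x : grad (fm F m) x = n%:R^-1 *: \sum_i grad (F m i) x.
Proof.
apply/rowP => j; rewrite !mxE summxE.
have dr i : derivable (F m i) x (delta_mx 0 j : V) by apply: diff_derivable; exact: dF.
have -> : fm F m = n%:R^-1 \*: (\sum_i F m i).
  by apply/funext => z; rewrite /fm /= fct_sumE.
rewrite deriveZ; last exact: derivable_sum.
by rewrite derive_sum//; congr (_ * _); apply: eq_bigr => i _; rewrite mxE.
Qed.

(** The average of the component bounds [bregman_le] at [xs]. It yields both the stationarity of
    [xs] and the comparison of [mu] with [L]. *)
Lemma ftot_upper z : ftot F z - ftot F xs <=
  M%:R^-1 * dotv (\sum_m grad (fm F m) xs) (z - xs) + L * sqnorm (z - xs).
Proof.
have -> : L * sqnorm (z - xs) = M%:R^-1 * \sum_(m < M) L * sqnorm (z - xs).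
  by rewrite mean_const.
rewrite /ftot -mulrBr -mulrDr ler_pM2l ?invr_gt0// -sumrB dotv_suml -big_split/=.
apply: ler_sum => m _; rewrite grad_fm dotvZl dotv_suml.
have -> : L * sqnorm (z - xs) = n%:R^-1 * \sum_(i < n) L * sqnorm (z - xs).
  by rewrite mean_const.
rewrite /fm -mulrBr -mulrDr ler_pM2l ?invr_gt0// -sumrB -big_split/=.
apply: ler_sum => i _.
by have := bregman_le L0 (@dF m i) (@cF m i) (@sF m i) z xs; rewrite /bregman; lra.
Qed.

Lemma sum_grad_fm_min : \sum_m grad (fm F m) xs = 0.
Proof.
set G := \sum_m _; apply: sqnorm0_eq0; apply/eqP; rewrite eq_le sqnorm_ge0 andbT.
(* This step length minimises the quadratic upper bound, which becomes a negative multiple of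
   [sqnorm G]; minimality of [xs] then forces [G = 0]. *)
pose c := (2 * L * M%:R)^-1.
have := ftot_upper (xs - c *: G).
rewrite -/G [_ - _ - xs]addrAC subrr add0r dotvNr dotvZr sqnormN sqnormZ.
have := xs_min (xs - c *: G); rewrite -subr_ge0 => /le_trans h /h.
rewrite -[dotv G G]/(sqnorm G).
have -> : M%:R^-1 * - (c * sqnorm G) + L * (c ^+ 2 * sqnorm G) =
    - ((4 * L * M%:R ^+ 2)^-1 * sqnorm G).
  by rewrite /c; field; rewrite !gt_eqF.
rewrite oppr_ge0 pmulr_rle0// invr_gt0 !mulr_gt0//.
Qed.

Lemma ftot_lower x : mu / 2 * sqnorm (x - xs) <= ftot F x - ftot F xs.
Proof.
rewrite leNgt; apply/negP => hlt.
set r := sqnorm (x - xs) in hlt *; set D := ftot F x - ftot F xs in hlt.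
have D0 : 0 <= D by rewrite subr_ge0.
have b0 : 0 < mu / 2 * r by exact: le_lt_trans hlt.
(* Instead of a limit [t -> 0], a choice making [(1 - t) * (mu / 2 * r)] the midpoint of [D] and
   [mu / 2 * r], hence larger than [D], whereas strong convexity and minimality make it at most
   [D]. *)
pose t := (mu / 2 * r - D) / (2 * (mu / 2 * r)).
have t0 : 0 < t by rewrite divr_gt0 ?subr_gt0// mulr_gt0.
have tE : t * (mu / 2 * r) = (mu / 2 * r - D) / 2.
  by rewrite /t; move: b0; move: (mu / 2 * r) => b b0; field; rewrite gt_eqF.
have t1 : t <= 1 by rewrite ler_pdivrMr; [lra|rewrite mulr_gt0].
have := @scf x xs t; rewrite (ltW t0) t1 => /(_ isT).
have := xs_min (t *: x + (1 - t) *: xs); rewrite -/r => h1 h2.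
have : 0 <= t * (D - (1 - t) * (mu / 2 * r)) by rewrite /D; lra.
by rewrite pmulr_rge0//; lra.
Qed.

(** The factor [sqnorm (x - xs)] is kept because in dimension 0 it always vanishes and [mu] can
    exceed [2 * L]. *)
Lemma mu_le_2L x : mu * sqnorm (x - xs) <= 2 * L * sqnorm (x - xs).
Proof.
have := ftot_lower x; have := ftot_upper x.
rewrite sum_grad_fm_min dotv0l; lra.
Qed.

(** The client average of the drift noise [W]. It involves only gradients at [xs], so it can be
    averaged over the permutations separately from the current point. *)
Definition prefix_noise (p : {ffun 'I_M -> 'S_n}) : R :=
  M%:R^-1 * \sum_(m < M) (n%:R^-1 * \sum_(i < n)
    sqnorm (\sum_(j < n | (j < i)%N) grad (F m (p m j)) xs)).

Definition cohort_factor : R := (M - C)%:R / (C%:R * (maxn (M - 1) 1)%:R).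

Lemma cohort_factor_ge0 : 0 <= cohort_factor.
Proof. by rewrite divr_ge0 ?mulr_ge0 ?ler0n. Qed.

Lemma cohort_factor_le1 : cohort_factor <= 1.
Proof.
rewrite ler_pdivrMr ?mulr_gt0// ?ltr0n ?leq_max ?orbT// mul1r -natrM ler_nat.
by rewrite subn_le_muln_max.
Qed.

Definition client_direction (p : {ffun 'I_M -> 'S_n}) (x : V) (m : 'I_M) : V :=
  (gamma * n%:R)^-1 *: (x - local_run F gamma m (p m) x).

Lemma local_runE m (q : 'S_n) x :
  local_run F gamma m q x = pass_prefix (fun i => F m (q i)) gamma x n.
Proof. by rewrite /pass_prefix take_oversize// size_enum_ord. Qed.

(** The estimates of a single pass for the family permuted by [p m]; averages over all components
    are unchanged by this reindexing. The existential [D] hides the local iterates. *)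
Lemma client_bounds p x m : exists D : R, [/\ 0 <= D,
  sqnorm (client_direction p x m - grad (fm F m) xs) <= 4 * L * D &
  fm F m x - fm F m xs + D / 2 - 2 * L * gamma ^+ 2 *
    (n%:R^-1 * \sum_(i < n) sqnorm (\sum_(j < n | (j < i)%N) grad (F m (p m j)) xs))
  <= dotv (client_direction p x m) (x - xs)].
Proof.
pose h (i : 'I_n) := F m (p m i).
have small : 16 * L * (gamma * n%:R) <= 1.
  by apply: le_trans etaL; rewrite ler_pM2l// mulr_gt0.
have dh i : differentiable_everywhere (h i) by exact: dF.
have ch i : convex_fun (h i) by exact: cF.
have sh i : smooth L (h i) by exact: sF.
have reidx (U : nmodType) (a : 'I_n -> U) : \sum_i a (p m i) = \sum_i a i.
  by rewrite [RHS](reindex_inj (@perm_inj _ (p m))).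
exists (n%:R^-1 * \sum_i bregman (h i) xs (pass_prefix h gamma x i)); split.
- exact: avg_bregman_ge0.
- rewrite /client_direction local_runE grad_fm -(reidx _ (fun i => grad (F m i) xs)).
  exact: pass_direction_dev.
- rewrite /client_direction local_runE /fm -mulrBr -sumrB.
  rewrite -(reidx _ (fun i => F m i x - F m i xs)).
  exact: pass_progress.
Qed.

(** The gradients of the [fm F m] at [xs] sum to zero, so they can be subtracted from the mean
    direction for free; for individual directions they remain and produce [sigma_star2]. *)
Lemma avg_client_direction p x : exists D : R, [/\ 0 <= D,
  sqnorm (M%:R^-1 *: \sum_m client_direction p x m) <= 4 * L * D,
  M%:R^-1 * \sum_m sqnorm (client_direction p x m) <= 8 * L * D + 2 * sigma_star2 F xs &
  ftot F x - ftot F xs + D / 2 - 2 * L * gamma ^+ 2 * prefix_noise p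
  <= M%:R^-1 * \sum_m dotv (client_direction p x m) (x - xs)].
Proof.
pose D m := sval (cid (client_bounds p x m)).
have DP m : [/\ 0 <= D m,
  sqnorm (client_direction p x m - grad (fm F m) xs) <= 4 * L * D m &
  fm F m x - fm F m xs + D m / 2 - 2 * L * gamma ^+ 2 *
    (n%:R^-1 * \sum_(i < n) sqnorm (\sum_(j < n | (j < i)%N) grad (F m (p m j)) xs))
  <= dotv (client_direction p x m) (x - xs)] := svalP (cid (client_bounds p x m)).
have Mi : 0 < M%:R^-1 :> R by rewrite invr_gt0.
exists (M%:R^-1 * \sum_m D m); split.
- by rewrite mulr_ge0 ?(ltW Mi)// sumr_ge0// => m _; case: (DP m).
- have -> : \sum_m client_direction p x m =
      \sum_m (client_direction p x m - grad (fm F m) xs).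
    by rewrite sumrB sum_grad_fm_min subr0.
  apply: (le_trans (sqnorm_avg_le M0 _)); rewrite [leRHS]mulrCA ler_pM2l// mulr_sumr.
  by apply: ler_sum => m _; case: (DP m).
- rewrite /sigma_star2 !(mulrCA _ M%:R^-1) -mulrDr ler_pM2l// !mulr_sumr -big_split/=.
  apply: ler_sum => m _; have [_ h _] := DP m.
  have := sqnormD_le (client_direction p x m - grad (fm F m) xs) (grad (fm F m) xs).
  by rewrite subrK; lra.
- rewrite /ftot /prefix_noise -mulrBr -[_ * _ / 2]mulrA.
  rewrite (mulrCA (2 * L * _)) -mulrDr -mulrBr ler_pM2l// -sumrB mulr_suml.
  rewrite -big_split/= mulr_sumr -sumrB.
  by apply: ler_sum => m _; case: (DP m).
Qed.

(** With the permutations fixed, the square is expanded: the cross term is linear in the cohort and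
    is averaged exactly, the quadratic term is bounded by the sampling second moment. *)
Lemma cohort_step p x :
  \sum_(S : {set 'I_M} | #|S| == C) sqnorm (nastya_step F gamma eta C x (S, p) - xs) <=
  #|[pred S : {set 'I_M} | #|S| == C]|%:R *
  ((1 - eta * mu) * sqnorm (x - xs) + 4 * eta * L * gamma ^+ 2 * prefix_noise p
    + 2 * eta ^+ 2 * cohort_factor * sigma_star2 F xs).
Proof.
set K := #|_|%:R; set g := client_direction p x.
have cardA (S : {set 'I_M}) : #|S| == C -> #|S| = C by move/eqP.
have exA (s : {perm 'I_M}) := @cohort_exchangeable R M C s.
have m1 := sum_sampling cardA exA (fun m => dotv (g m) (x - xs)).
have m2 := sampling_second_moment cardA exA g.
rewrite card_ord in m1 m2; move/(_ M0 CM) : m2 => m2.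
rewrite -/K in m1 m2.
have -> : \sum_(S : {set 'I_M} | #|S| == C) sqnorm (nastya_step F gamma eta C x (S, p) - xs) =
   K * sqnorm (x - xs)
   - 2 * eta * C%:R^-1 * \sum_(S : {set 'I_M} | #|S| == C) \sum_(m in S) dotv (g m) (x - xs)
   + (eta * C%:R^-1) ^+ 2 *
      \sum_(S : {set 'I_M} | #|S| == C) sqnorm (\sum_(m in S) g m).
  have -> : K * sqnorm (x - xs) = \sum_(S : {set 'I_M} | #|S| == C) sqnorm (x - xs).
    by rewrite sumr_const -[RHS]mulr_natl.
  rewrite !mulr_sumr -sumrB -big_split/=; apply: eq_bigr => S _.
  have -> : nastya_step F gamma eta C x (S, p) - xs =
      (x - xs) - (eta * C%:R^-1) *: \sum_(m in S) g m.
    by rewrite -scalerA addrAC.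
  by rewrite (sqnormB (x - xs)) sqnormZ dotvZr -dotv_suml (dotvC (x - xs)); ring.
have {}m1 : \sum_(S : {set 'I_M} | #|S| == C) \sum_(m in S) dotv (g m) (x - xs) =
    K * C%:R * (M%:R^-1 * \sum_m dotv (g m) (x - xs)).
  apply: (mulfI (x := M%:R)); first by rewrite gt_eqF.
  by rewrite m1; field; rewrite gt_eqF.
have K0 : 0 <= K by rewrite ler0n.
have [D [D0 hD1 hD2 hD3]] := avg_client_direction p x.
rewrite -/g in hD1 hD2 hD3.
set s1 := M%:R^-1 * \sum_m dotv _ _ in m1 hD3.
set s2 := M%:R^-1 * \sum_m sqnorm _ in m2 hD2.
have {}m2 : (eta * C%:R^-1) ^+ 2 * \sum_(S : {set 'I_M} | #|S| == C)
     sqnorm (\sum_(m in S) g m) <=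
   K * (eta ^+ 2 * (sqnorm (M%:R^-1 *: \sum_m g m) + cohort_factor * s2)).
  apply: le_trans (ler_wpM2l (sqr_ge0 _) m2) _; rewrite le_eqVlt; apply/orP; left.
  by rewrite /cohort_factor; apply/eqP; field; rewrite !gt_eqF// ltr0n leq_max orbT.
rewrite m1; apply: le_trans (lerD (lexx _) m2) _.
have -> : K * sqnorm (x - xs) - 2 * eta / C%:R * (K * C%:R * s1) =
    K * (sqnorm (x - xs) - 2 * eta * s1) by field; rewrite gt_eqF.
rewrite -mulrDr; apply: ler_wpM2l => //.
have hlow := ftot_lower x.
have r0 := cohort_factor_ge0; have r1 := cohort_factor_le1.
have h1 : eta * (mu / 2 * sqnorm (x - xs) + D / 2 - 2 * L * gamma ^+ 2 * prefix_noise p)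
   <= eta * s1 by rewrite ler_pM2l//; lra.
have h2 : eta ^+ 2 * (sqnorm (M%:R^-1 *: \sum_m g m) + cohort_factor * s2) <=
   eta ^+ 2 * (4 * L * D + (8 * L * D + cohort_factor * (2 * sigma_star2 F xs))).
  apply: ler_wpM2l; first exact: sqr_ge0.
  apply: lerD => //; apply: le_trans (ler_wpM2l r0 hD2) _.
  rewrite mulrDr lerD2r ler_piMl// !mulr_ge0// ltW//.
(* The quadratic term costs [4 L eta^2 D] from the mean direction and [8 L eta^2 D] from the cohort
   variance; the cross term offers [2 eta (D / 2) = eta D]. *)
have h3 : 12 * (L * eta * (eta * D)) <= eta * D.
  have : 16 * L * eta * (eta * D) <= eta * D by rewrite ler_piMl// mulr_ge0// ltW.
  have : 0 <= L * eta * (eta * D) by rewrite !mulr_ge0// ltW.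
  lra.
lra.
Qed.

(** The first [i] entries of a random permutation form an exchangeable set of size [i], so the
    sampling second moment applies; then [i^2 <= n^2] and its variance factor is at most [n]. *)
Lemma avg_prefix_noise :
  \sum_(p : {ffun 'I_M -> 'S_n}) prefix_noise p <=
  #|{ffun 'I_M -> 'S_n}|%:R *
    (n%:R * (M%:R^-1 * \sum_(m < M) sigma_star_m2 F xs m + n%:R * sigma_star2 F xs)).
Proof.
set P := #|_|%:R.
have -> : P * (n%:R * (M%:R^-1 * \sum_(m < M) sigma_star_m2 F xs m + n%:R * sigma_star2 F xs)) =
  M%:R^-1 * \sum_(m < M) (n%:R^-1 * \sum_(i < n)
    P * (n%:R ^+ 2 * sqnorm (grad (fm F m) xs) + n%:R * sigma_star_m2 F xs m)).
  rewrite (mulrCA n%:R M%:R^-1) -mulrDr !(mulrCA _ M%:R^-1); congr (_ * _).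
  rewrite mulr_sumr -big_split/= !mulr_sumr; apply: eq_bigr => m _.
  by rewrite mean_const//; ring.
rewrite /prefix_noise -mulr_sumr ler_pM2l ?invr_gt0// exchange_big/=.
apply: ler_sum => m _; rewrite -mulr_sumr ler_pM2l ?invr_gt0// exchange_big/=.
apply: ler_sum => i _.
have in_ := ltnW (ltn_ord i).
have cardU (p : {ffun 'I_M -> 'S_n}) : xpredT p ->
    #|p m @: [set j : 'I_n | (j < i)%N]| = i.
  by rewrite card_imset ?card_ord_prefix//; exact: perm_inj.
have exU (s : 'S_n) := @prefix_exchangeable R M n i m s.
have := sampling_second_moment cardU exU (fun j => grad (F m j) xs).
rewrite card_ord => /(_ n0 in_); rewrite -/P -grad_fm -/(sigma_star_m2 F xs m) => h.
apply: le_trans (le_trans h _).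
  rewrite le_eqVlt; apply/orP; left; apply/eqP; apply: eq_bigr => p _; congr sqnorm.
  rewrite big_imset/=; last by move=> ? ? _ _; exact: perm_inj.
  by apply: eq_bigl => j; rewrite inE.
rewrite ler_wpM2l// lerD// ler_wpM2r ?sqnorm_ge0//.
- by rewrite ler_pXn2r ?nnegrE// ler_nat.
- by rewrite mulr_ge0 ?invr_ge0// sumr_ge0// => j _; exact: sqnorm_ge0.
- rewrite ler_pdivrMr ?ltr0n ?leq_max ?orbT// -!natrM ler_nat.
  by rewrite muln_sub_le_max.
Qed.

Lemma round_contraction x :
  \sum_(o : round_outcome M n | valid_outcome C o)
     sqnorm (nastya_step F gamma eta C x o - xs) <=
  #|@valid_outcome M n C|%:R *
  ((1 - eta * mu) * sqnorm (x - xs) +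
   (4 * eta * L * gamma ^+ 2 *
     (n%:R * (M%:R^-1 * \sum_(m < M) sigma_star_m2 F xs m + n%:R * sigma_star2 F xs))
    + 2 * eta ^+ 2 * cohort_factor * sigma_star2 F xs)).
Proof.
have sumE (G : round_outcome M n -> R) : \sum_(o | valid_outcome C o) G o =
    \sum_p \sum_(S : {set 'I_M} | #|S| == C) G (S, p).
  rewrite exchange_big/= pair_big_dep/=.
  by apply: eq_big => [[S p]|[S p] _]//=; rewrite andbT.
have -> : #|@valid_outcome M n C|%:R =
   #|{ffun 'I_M -> 'S_n}|%:R * #|[pred S : {set 'I_M} | #|S| == C]|%:R :> R.
  transitivity (\sum_(o : round_outcome M n | valid_outcome C o) (1 : R)).
    by rewrite sumr_const.
  by rewrite sumE !sumr_const -natrM -mulrnA mulnC.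
rewrite sumE; apply: le_trans (ler_sum _ (fun p _ => cohort_step p x)) _.
rewrite -mulr_sumr -[X in _ <= X]mulrA [X in _ <= X]mulrCA; apply: ler_wpM2l => //.
have sum_cst (c : R) :
    \sum_(p : {ffun 'I_M -> 'S_n}) c = #|{ffun 'I_M -> 'S_n}|%:R * c.
  by rewrite sumr_const [RHS]mulr_natl.
rewrite !big_split/= !sum_cst -mulr_sumr.
have e0 : 0 <= 4 * eta * L * gamma ^+ 2.
  by rewrite !mulr_ge0 ?exprn_ge0// ltW.
have := ler_wpM2l e0 avg_prefix_noise; lra.
Qed.

End Server.

Theorem theorem1 (R : realType) (d M n : nat)
    (F : 'I_M -> 'I_n -> 'rV[R]_d -> R) (L mu gamma eta : R) (C T : nat)
    (x0 xs : 'rV[R]_d) :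
  (0 < M)%N -> (0 < n)%N ->
  (forall m i, differentiable_everywhere (F m i)) ->
  (forall m i, convex_fun (F m i)) ->
  (forall m i, smooth L (F m i)) ->
  smooth L (ftot F) ->
  0 < mu -> strongly_convex mu (ftot F) ->
  (forall y, ftot F xs <= ftot F y) ->
  0 < gamma -> 0 <= eta ->
  (1 <= C)%N -> (C <= M)%N ->
  gamma * n%:R <= eta -> eta <= (16 * L)^-1 ->
  (1 <= T)%N ->
  expect (R:=R) (M:=M) (n:=n) C (T:=T) (fun w => sqnorm (nastya_iterate F gamma eta C x0 w - xs))
    <= (1 - eta * mu / 2) ^+ T * sqnorm (x0 - xs)
       + 5 * gamma ^+ 2 * n%:R * L / mu
           * (M%:R^-1 * \sum_(m < M) sigma_star_m2 F xs m + n%:R * sigma_star2 F xs)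
       + 8 * eta / mu * ((M - C)%:R / (C%:R * (maxn (M - 1) 1)%:R))
           * sigma_star2 F xs.
Proof.
move=> M0 n0 dF cF sF _ mu0 scf xs_min gamma0 eta_ge0 C0 CM gamma_eta etaL _.
have eta0 : 0 < eta by apply: lt_le_trans gamma_eta; rewrite mulr_gt0// ltr0n.
have L0 : 0 < L.
  by have := lt_le_trans eta0 etaL; rewrite invr_gt0 pmulr_rgt0.
have {}etaL : 16 * L * eta <= 1.
  by move: etaL; rewrite -[X in _ <= X]mul1r ler_pdivlMr ?mulr_gt0// mulrC.
set sig := sigma_star2 F xs.
set sigm := M%:R^-1 * \sum_(m < M) sigma_star_m2 F xs m.
rewrite -/(@cohort_factor R M C); set rho := @cohort_factor R M C.
have sig0 : 0 <= sig.
  by rewrite mulr_ge0 ?invr_ge0 ?ler0n// sumr_ge0// => m _; exact: sqnorm_ge0.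
have sigm0 : 0 <= sigm.
  rewrite mulr_ge0 ?invr_ge0 ?ler0n// sumr_ge0// => m _.
  by rewrite mulr_ge0 ?invr_ge0 ?ler0n// sumr_ge0// => i _; exact: sqnorm_ge0.
have rho0 : 0 <= rho by exact: cohort_factor_ge0.
(* The one-round noise divided by [eta * mu], i.e. the fixed point of the recursion with factor
   [1 - eta * mu]. *)
pose B := 4 * gamma ^+ 2 * n%:R * L / mu * (sigm + n%:R * sig) + 2 * eta / mu * rho * sig.
have noise0 : 0 <= gamma ^+ 2 * n%:R * L / mu * (sigm + n%:R * sig).
  apply: mulr_ge0; last by rewrite addr_ge0// mulr_ge0.
  by rewrite divr_ge0 ?(ltW mu0)// !mulr_ge0 ?exprn_ge0// ltW.
have cnoise0 : 0 <= eta / mu * rho * sig.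
  by rewrite mulr_ge0// mulr_ge0// divr_ge0// ltW.
have B0 : 0 <= B by rewrite /B; lra.
have BE : 5 * gamma ^+ 2 * n%:R * L / mu * (sigm + n%:R * sig) + 8 * eta / mu * rho * sig
    = B + (gamma ^+ 2 * n%:R * L / mu * (sigm + n%:R * sig) + 6 * (eta / mu * rho * sig)).
  by rewrite /B; ring.
rewrite -addrA BE.
have [Lmu|muL] := ltP (2 * L) mu.
  (* Then [R^d] is trivial, i.e. [d = 0]. *)
  have sq0 x : sqnorm (x - xs) = 0.
    have := mu_le_2L (mu := mu) M0 n0 dF cF sF scf xs_min L0 x.
    rewrite -subr_le0 -mulrBl pmulr_rle0 ?subr_gt0// => h.
    by apply/eqP; rewrite eq_le h sqnorm_ge0.
  rewrite /expect big1 => [|w _]; last exact: sq0.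
  by rewrite mul0r sq0 mulr0; lra.
(* Indeed [eta * mu <= 2 * L * eta <= 1 / 8]. *)
have q1 : 0 <= 1 - eta * mu.
  have : eta * mu <= eta * (2 * L) by rewrite ler_pM2l.
  lra.
have step x : \sum_(o : round_outcome M n | valid_outcome C o)
     sqnorm (nastya_step F gamma eta C x o - xs) <=
  #|@valid_outcome M n C|%:R *
  ((1 - eta * mu) * sqnorm (x - xs) + (1 - (1 - eta * mu)) * B).
  apply: le_trans (round_contraction M0 n0 dF cF sF scf xs_min gamma0 C0 CM gamma_eta
    L0 etaL x) _.
  rewrite -/sigm -/sig -/rho /B le_eqVlt; apply/orP; left; apply/eqP.
  by congr (_ * (_ + _)); field; rewrite gt_eqF.
have := rounds_contraction (Phi := fun x => sqnorm (x - xs)) T x0 q1 step.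
rewrite /expect (card_valid_rounds (@valid_outcome M n C)) natrX.
have N0 : 0 < #|@valid_outcome M n C|%:R :> R.
  rewrite ltr0n; apply/card_gt0P.
  (* A valid outcome, the first [C] clients with identity permutations, so the denominator of
     [expect] is nonzero. *)
  exists ([set i : 'I_M | (i < C)%N], [ffun=> 1%g]).
  by rewrite unfold_in /valid_outcome card_ord_prefix.
move=> h; rewrite ler_pdivrMr ?exprn_gt0// mulrC.
apply: le_trans h _; rewrite ler_pM2l ?exprn_gt0//.
have qT : (1 - eta * mu) ^+ T <= (1 - eta * mu / 2) ^+ T.
  have em : 0 <= eta * mu by rewrite mulr_ge0// ltW.
  by apply: lerXn2r; rewrite ?nnegrE//; lra.
have := ler_wpM2r (sqnorm_ge0 (x0 - xs)) qT.
have : 0 <= (1 - eta * mu) ^+ T * B by rewrite mulr_ge0// exprn_ge0.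
lra.
Qed.
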